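(* Let $r\ge 2$ be an integer, $n=(r+1)^2$ and $k=r^2-r+1$. For $x\in\{1,\dots,2r+1\}$ let $f(x)=x(r+1)-\frac{x^2}{4}$ if $x$ is even and $f(x)=x(r+1)-\frac{x^2-1}{4}$ if $x$ is odd, and let $\mu_k=\max\{x\in\{1,\dots,2r+1\} : f(x)-x\le k-1\}$. Then for every prime power $q>\binom{n}{k+\mu_k}$ there exists an $[n,k]$ linear code over $\mathbb{F}_q$ with all symbol $(r,3)_c$-locality whose minimum distance $d$ satisfies $$d \;\ge\; n-k+1-\bigl(2(r-\lfloor\sqrt{r-1}\rfloor)-1\bigr).$$ Consequently, with $\delta=3$, $$d-\Bigl(n-k+1-\bigl(\lceil k/r\rceil-1\bigr)(\delta-1)\Bigr)\;\ge\; 2\bigl(\lfloor\sqrt{r-1}\rfloor-1\bigr)+1=\Omega(\sqrt{r}),$$ while the information rate $k/n=(r^2-r+1)/(r+1)^2$ tends to $1$ as $r\to\infty$.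
   Context: An $[n,k]$ linear code over $\mathbb{F}_q$ is a $k$-dimensional linear subspace $\mathcal{C}\subseteq\mathbb{F}_q^n$; its minimum distance is the minimum Hamming distance. Let $G=(g_1,\dots,g_n)$ be a $k\times n$ generator matrix of $\mathcal{C}$, with columns $g_i\in\mathbb{F}_q^k$, and for $N\subseteq[n]=\{1,\dots,n\}$ let $\operatorname{span}(N)$ be the $\mathbb{F}_q$-linear span of $\{g_i:i\in N\}$. The $i$-th coordinate of $\mathcal{C}$ has $(r,\delta)_c$-locality if there exist $\delta-1$ pairwise disjoint sets $R^{(i)}_1,\dots,R^{(i)}_{\delta-1}\subseteq[n]\setminus\{i\}$ such that for every $1\le\xi\le\delta-1$: $|R^{(i)}_\xi|\le r$ and $g_i\in\operatorname{span}(R^{(i)}_\xi)$. The code has all symbol $(r,\delta)_c$-locality if every coordinate $i\in[n]$ has $(r,\delta)_c$-locality. The quantity $n-k+1-(\lceil k/r\rceil-1)(\delta-1)$ is the upper bound on the minimum distance of $[n,k]$ codes with the (different) notion of locality $(r,\delta)$ due to Prakash et al. *)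

(* Defs.v *)
From mathcomp Require Import all_boot all_order all_algebra.

Set Implicit Arguments.
Unset Strict Implicit.
Unset Printing Implicit Defensive.

Import Order.TTheory GRing.Theory Num.Theory.

Local Open Scope ring_scope.

Definition generator_matrix (F : fieldType) (n k : nat)
    (C : {vspace 'rV[F]_n}) (G : 'M[F]_(k, n)) : Prop :=
  basis_of C [seq row i G | i <- enum 'I_k].

(* Every code has a generator matrix, so universal quantification over the
   generator matrices of a code is never vacuous. *)
Lemma generator_matrix_exists (F : fieldType) (n : nat)
    (C : {vspace 'rV[F]_n}) :
  exists G : 'M[F]_(\dim C, n), generator_matrix C G.
Proof.
exists (\matrix_i (vbasis C)`_i); rewrite /generator_matrix.
have -> : [seq row i (\matrix_(i < \dim C) (vbasis C)`_i) | i <- enum 'I_(\dim C)]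
          = vbasis C.
  apply: (@eq_from_nth _ 0); first by rewrite size_map size_enum_ord size_tuple.
  move=> i; rewrite size_map size_enum_ord => lti.
  by rewrite (nth_map (Ordinal lti)) ?size_enum_ord // rowK nth_enum_ord.
exact: vbasisP.
Qed.

Definition col_span (F : fieldType) (k n : nat) (G : 'M[F]_(k, n))
    (N : {set 'I_n}) : {vspace 'cV[F]_k} :=
  <<[seq col j G | j <- enum N]>>%VS.

Definition coord_locality (F : fieldType) (k n : nat) (G : 'M[F]_(k, n))
    (r delta : nat) (i : 'I_n) : Prop :=
  exists R : 'I_(delta - 1) -> {set 'I_n},
    (forall xi, [/\ i \notin R xi, (#|R xi| <= r)%N
                  & col i G \in col_span G (R xi)]) /\
    (forall xi zeta, xi != zeta -> [disjoint R xi & R zeta]).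

(* Whether a coordinate has the locality property does not depend on the
   generator matrix: two of them differ by an invertible left factor. *)
Definition all_symbol_locality (F : fieldType) (n : nat)
    (C : {vspace 'rV[F]_n}) (r delta : nat) : Prop :=
  forall (k : nat) (G : 'M[F]_(k, n)), generator_matrix C G ->
  forall i : 'I_n, coord_locality G r delta i.

Definition hamming_dist (F : fieldType) (n : nat) (u v : 'rV[F]_n) : nat :=
  #|[set i | u 0 i != v 0 i]|.

Definition is_min_dist (F : fieldType) (n : nat) (C : {vspace 'rV[F]_n})
    (d : nat) : Prop :=
  (exists u v, [/\ u \in C, v \in C, u != v & hamming_dist u v = d]) /\
  (forall u v, u \in C -> v \in C -> u != v -> (d <= hamming_dist u v)%N).

(* The divisions by 4 are exact, and no subtraction truncates for
   1 <= x <= 2 * r + 1. *)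
Definition f_lines (r x : nat) : nat :=
  if odd x then (x * (r + 1) - (x ^ 2 - 1) %/ 4)%N
  else (x * (r + 1) - x ^ 2 %/ 4)%N.

(* The index set is nonempty for k = r ^ 2 - r + 1 with r >= 2, as it
   contains 1; there f_lines r x >= x, so its subtractions do not truncate. *)
Definition mu (r k : nat) : nat :=
  (\max_(1 <= x < (2 * r + 1).+1 | f_lines r x - x <= k - 1) x)%N.

(* Main.v *)
Require Import Defs.
From mathcomp Require Import all_boot all_order all_algebra all_field.
From mathcomp Require Import zify.

Set Implicit Arguments.
Unset Strict Implicit.
Unset Printing Implicit Defensive.

Import Order.TTheory GRing.Theory Num.Theory.

Local Open Scope ring_scope.

(** Let [P] be the code of the (r+1) x (r+1) arrays all of whose row sums and
   column sums vanish: it has dimension at least r^2, and the rest of its row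
   and the rest of its column are two disjoint recovering sets of size r for
   each cell.  This recovery property passes to subcodes of [P], so it suffices
   to find a k-dimensional subspace of [P] that, for every set [M] of
   3r - mu_k cells, meets the space [P_M] of the words of [P] supported on [M]
   trivially: its distance then exceeds 3r - mu_k.  There are
   C(n, k + mu_k) < q such [M], hence a greedy choice of basis vectors works as
   soon as dim P_M <= r^2 - k = r - 1.

   For this dimension bound, view [M] as a bipartite graph between rows and
   columns, so that [P_M] is its cycle space.  Let [L] be the set of leading
   positions of [P_M] for the lexicographic order on cells, and let [u] and [v]
   be the numbers of rows and of columns that [L] meets.  Then
   dim P_M <= |L| <= u v, and the other positions of [M] carry the restrictions
   of u + v + 1 independent cuts, so |M| >= |L| + u + v + 1.  If dim P_M >= r,
   then u v >= r forces u + v >= 2r - mu_k and |M| >= 3r - mu_k + 1. *)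

(** * Subspaces in general position *)

Lemma exists_set_of_card (T : finType) (A : {set T}) (e : nat) :
  (#|A| <= e <= #|T|)%N -> exists2 B : {set T}, A \subset B & #|B| = e.
Proof.
case/andP=> leAe; elim: e leAe => [|e IH] leAe leeT.
  by exists A => //; apply/eqP; rewrite -leqn0.
move: leAe; rewrite leq_eqVlt => /orP[/eqP <-|leAe]; first by exists A.
have [B sAB cB] := IH leAe (ltnW leeT).
have [x xB] : exists x, x \in ~: B.
  by apply/set0Pn; rewrite -card_gt0 cardsCs setCK cB subn_gt0.
exists (x |: B); first by rewrite (subset_trans sAB) // subsetUr.
by rewrite cardsU1 cB; move: xB; rewrite inE => ->.
Qed.

(** With [q = #|F|], each [W i] has at most [q ^ (dim V - 1)] vectors, so fewer than [q] of them
    cannot cover [V]. *)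
Lemma vspace_avoid (F : finFieldType) (n : nat) (I : finType)
    (A : {set I}) (V : {vspace 'rV[F]_n}) (W : I -> {vspace 'rV[F]_n}) :
  (#|A| < #|F|)%N -> (forall i, i \in A -> (\dim (W i) < \dim V)%N) ->
  exists2 v, v \in V & forall i, i \in A -> v \notin W i.
Proof.
move=> ltAF ltWV.
pose toset (U : {vspace 'rV[F]_n}) := [set v | v \in U].
have card_toset U : #|toset U| = (#|F| ^ \dim U)%N.
  by rewrite cardsE card_vspace.
have [sub|] := boolP (toset V \subset \bigcup_(i in A) toset (W i)).
  suff: (#|toset V| < #|F| ^ \dim V)%N by rewrite card_toset ltnn.
  apply: leq_ltn_trans (subset_leq_card sub) _.
  apply: (@leq_ltn_trans (\sum_(i in A) #|toset (W i)|)).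
    apply: (big_ind2 (fun (B : {set 'rV[F]_n}) s => (#|B| <= s)%N))
      => [|B1 s1 B2 s2 le1 le2|//].
      by rewrite cards0.
    exact: leq_trans (leq_card_setU _ _) (leq_add le1 le2).
  have leW i : i \in A -> (#|toset (W i)| <= #|F| ^ (\dim V).-1)%N.
    move=> iA; rewrite card_toset leq_exp2l ?finNzRing_gt1 //.
    by have := ltWV i iA; case: (\dim V).
  apply: leq_ltn_trans (leq_sum _ leW) _; rewrite sum_nat_const.
  have [->|] := posnP #|A|.
    by rewrite mul0n expn_gt0 (leq_ltn_trans _ ltAF).
  rewrite card_gt0 => /set0Pn[i iA].
  have := ltWV i iA; case: (\dim V) => // d _ /=.
  by rewrite expnS ltn_mul2r expn_gt0 (leq_ltn_trans _ ltAF).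
case/subsetPn=> v; rewrite inE => vV vW; exists v => // i iA.
by apply: contra vW => vWi; apply/bigcupP; exists i => //; rewrite inE.
Qed.

Lemma dim_addv_line (F : fieldType) (vT : vectType F) (U : {vspace vT}) v :
  v \notin U -> \dim (U + <[v]>) = (\dim U).+1.
Proof.
move=> vU; rewrite dimv_disjoint_sum ?dim_vline.
  suff -> : v != 0 by rewrite addn1.
  by apply: contraNneq vU => ->; rewrite mem0v.
apply/eqP; rewrite -subv0; apply/subvP => x; rewrite memv_cap => /andP[xU].
case/vlineP=> a def_x; move: xU; rewrite def_x memv0.
have [->|a0] := eqVneq a 0; first by rewrite scale0r.
by rewrite rpredZeq (negPf a0) (negPf vU).
Qed.

(* The new vector has to avoid the sums [C + W i], which are proper because
   [\dim C < k]. *)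
Lemma generic_subspace (F : finFieldType) (n : nat) (I : finType)
    (A : {set I}) (V : {vspace 'rV[F]_n}) (W : I -> {vspace 'rV[F]_n})
    (k : nat) :
  A != set0 -> (#|A| < #|F|)%N ->
  (forall i, i \in A -> (k + \dim (W i) <= \dim V)%N) ->
  exists C : {vspace 'rV[F]_n},
    [/\ (C <= V)%VS, \dim C = k
      & forall i, i \in A -> (C :&: W i)%VS = 0%VS].
Proof.
move=> /set0Pn[i0 i0A] ltAF; elim: k => [|k IH] leWV.
  by exists 0%VS; split=> [||i _]; rewrite ?sub0v ?dimv0 ?cap0v.
have [i iA|C [sCV dimC capC]] := IH; first exact: ltnW (leWV i iA).
have [i iA|v vV vCW] := @vspace_avoid F n I A V (fun i => C + W i)%VS ltAF.
  apply: leq_trans (leWV i iA); rewrite addSn ltnS -dimC -dimv_sum_cap.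
  exact: leq_addr.
exists (C + <[v]>)%VS; split.
- by rewrite subv_add sCV -memvE.
- rewrite dim_addv_line ?dimC //.
  by apply: contra (vCW _ i0A) => vC; rewrite (subvP (addvSl _ _)).
move=> i iA; apply/eqP; rewrite -dimv_eq0.
(* Adding [v] raises the dimensions of [C] and of [C + W i] by one each, so the intersection with
   [W i] stays trivial by Grassmann's formula. *)
have := dimv_sum_cap (C + <[v]>) (W i).
rewrite -addvA (addvC <[v]>%VS) addvA.
rewrite dim_addv_line ?vCW // dim_addv_line; last first.
  by apply: contra (vCW _ iA) => vC; rewrite (subvP (addvSl _ _)).
have := dimv_sum_cap C (W i); rewrite capC // dimv0.
lia.
Qed.

(** * Leading positions of words with zero line sums *)

(** These are the pivot columns of an echelon basis of [Z]. *)
Definition leads (F : finFieldType) (n : nat) (Z : {vspace 'rV[F]_n}) :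
    {set 'I_n} :=
  [set i | [exists w : 'rV[F]_n, [&& w \in Z, w 0 i != 0
     & [forall j : 'I_n, (j < i)%N ==> (w 0 j == 0)]]]].

Lemma leadsP (F : finFieldType) (n : nat) (Z : {vspace 'rV[F]_n}) (i : 'I_n) :
  reflect (exists w : 'rV[F]_n, [/\ w \in Z, w 0 i != 0
             & forall j : 'I_n, (j < i)%N -> w 0 j = 0])
          (i \in leads Z).
Proof.
rewrite inE; apply: (iffP existsP) => -[w].
  case/and3P=> wZ wi /forallP w0; exists w.
  by split=> // j /(implyP (w0 j))/eqP.
case=> wZ wi w0; exists w; apply/and3P; split=> //.
by apply/forallP=> j; apply/implyP=> /w0 ->.
Qed.

Lemma lead_of_neq0 (F : finFieldType) (n : nat) (Z : {vspace 'rV[F]_n}) w :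
  w \in Z -> w != 0 -> exists2 i, i \in leads Z & w 0 i != 0.
Proof.
move=> wZ w0; have [i0 wi0] : exists i, w 0 i != 0.
  apply/existsP; rewrite -negb_forall; apply: contra w0 => /forallP w0.
  by apply/eqP/rowP=> j; rewrite mxE; apply/eqP.
case: (@arg_minnP _ i0 (fun i => w 0 i != 0) (fun i : 'I_n => val i) wi0).
move=> i wi min_i; exists i => //.
apply/leadsP; exists w; split=> // j ltji; apply/eqP/negPn/negP=> /min_i.
by rewrite leqNgt ltji.
Qed.

(** A nonzero word does not vanish at its first support position, so restriction to the leading
    positions is injective on [Z]. *)
Lemma dim_le_leads (F : finFieldType) (n : nat) (Z : {vspace 'rV[F]_n}) :
  (\dim Z <= #|leads Z|)%N.
Proof.
set L := leads Z.
pose f : 'Hom('rV[F]_n, 'rV[F]_#|L|) := linfun (colsub (enum_val (A := mem L))).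
rewrite -(limg_dim_eq (f := f)).
  by rewrite (leq_trans (dimvS (subvf _))) ?dimvf /dim /= ?mul1n.
apply/eqP; rewrite -subv0; apply/subvP => w; rewrite memv_cap memv_ker memv0.
case/andP=> wZ; rewrite lfunE => /eqP fw; apply: contraT => w0.
have [i iL] := lead_of_neq0 wZ w0.
have /rowP/(_ (enum_rank_in iL i)) := fw.
by rewrite !mxE enum_rankK_in // => ->; rewrite eqxx.
Qed.

Definition zero_sums (F : fieldType) (n m : nat) (p : 'I_n -> 'I_m)
    (w : 'rV[F]_n) : Prop :=
  forall a, \sum_(i | p i == a) w 0 i = 0.

Lemma zero_sums_other (F : fieldType) (n m : nat) (p : 'I_n -> 'I_m)
    (w : 'rV[F]_n) (i : 'I_n) :
  zero_sums p w -> w 0 i != 0 -> exists j, [/\ j != i, p j = p i & w 0 j != 0].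
Proof.
move=> sum0 wi; have := sum0 (p i); rewrite (bigD1 i) //= => sumi.
suff: [exists j, [&& j != i, p j == p i & w 0 j != 0]].
  by case/existsP=> j /and3P[ji /eqP pj wj]; exists j.
apply: contraT => /existsPn none; case/eqP: wi.
move: sumi; rewrite big1 ?addr0 // => j /andP[pj ji].
by have := none j; rewrite ji pj /= negbK => /eqP.
Qed.

Lemma zero_sums_orthogonal (F : fieldType) (n m : nat) (p : 'I_n -> 'I_m)
    (w : 'rV[F]_n) (X : 'I_m -> F) :
  zero_sums p w -> \sum_i w 0 i * X (p i) = 0.
Proof.
move=> sum0; rewrite (partition_big p predT) //= big1 // => a _.
transitivity ((\sum_(i | p i == a) w 0 i) * X a); last by rewrite sum0 mul0r.
by rewrite mulr_suml; apply: eq_bigr => i /eqP ->.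
Qed.

(** This keeps what the proof uses of the lexicographic order; it also makes a cell determined by
    its row and column. *)
Definition grid_order (n m1 m2 : nat) (ro : 'I_n -> 'I_m1)
    (co : 'I_n -> 'I_m2) : Prop :=
  forall i j : 'I_n, (i < j)%N ->
    (ro i = ro j -> (co i < co j)%N) /\ (co i = co j -> (ro i < ro j)%N).

Lemma grid_order_inj (n m1 m2 : nat) (ro : 'I_n -> 'I_m1) (co : 'I_n -> 'I_m2)
    (i j : 'I_n) :
  grid_order ro co -> ro i = ro j -> co i = co j -> i = j.
Proof.
move=> ord rij cij; apply/val_inj; case: (ltngtP i j) => // /ord[H _].
  by have := H rij; rewrite cij ltnn.
by have := H (esym rij); rewrite cij ltnn.
Qed.

(** A zero sum forces a second nonzero cell on the line of [i], and a word led by [i] has none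
    before [i]. *)
Lemma leads_below (F : finFieldType) (n m : nat) (Z : {vspace 'rV[F]_n})
    (p : 'I_n -> 'I_m) (i : 'I_n) :
  (forall w, w \in Z -> zero_sums p w) -> i \in leads Z ->
  exists w j, [/\ w \in Z, w 0 i != 0, w 0 j != 0, p j = p i & (i < j)%N].
Proof.
move=> Zp /leadsP[w [wZ wi w0]].
have [j [ji pj wj]] := zero_sums_other (Zp w wZ) wi.
exists w, j; split=> //; rewrite ltn_neqAle eq_sym ji leqNgt.
by apply: contra wj => /w0 ->.
Qed.

(* Off the leading positions there is a spanning forest of the graph [M]:
   a cut vanishing there vanishes on all of [M] by orthogonality to [Z], and
   the leading positions tie its potential to that of a later line. *)
Lemma cut_eq0 (F : finFieldType) (n m1 m2 : nat) (ro : 'I_n -> 'I_m1)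
    (co : 'I_n -> 'I_m2) (M : {set 'I_n}) (Z : {vspace 'rV[F]_n})
    (X : 'I_m1 -> F) (Y : 'I_m2 -> F) (c : F) :
  grid_order ro co ->
  (forall w, w \in Z -> zero_sums ro w /\ zero_sums co w) ->
  (forall w i, w \in Z -> w 0 i != 0 -> i \in M) ->
  Z != 0%VS ->
  (forall a, a \notin ro @: leads Z -> X a = 0) ->
  (forall b, b \notin co @: leads Z -> Y b = 0) ->
  (forall i, i \in M :\: leads Z -> X (ro i) + Y (co i) + c = 0) ->
  [/\ forall a, X a = 0, forall b, Y b = 0 & c = 0].
Proof.
move=> ord Zsum ZM Z0 X0 Y0 cut0.
have Zro w : w \in Z -> zero_sums ro w by case/Zsum.
have Zco w : w \in Z -> zero_sums co w by case/Zsum.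
pose g i := X (ro i) + Y (co i) + c.
have orth w : w \in Z -> \sum_i w 0 i * g i = 0.
  move=> wZ; under eq_bigr => i _ do rewrite mulrDr mulrDr.
  rewrite !big_split /= (zero_sums_orthogonal _ (Zro w wZ)).
  rewrite (zero_sums_orthogonal _ (Zco w wZ)).
  rewrite (zero_sums_orthogonal (fun=> c) (Zro w wZ)).
  by rewrite !addr0.
(* Descending induction on [i]: orthogonality to a word led by [i] expresses [g i] through values of
   [g] at later cells of [M]. *)
have gM i : i \in M -> g i = 0.
  have [d] := ubnP (n - i); elim: d i => // d IH i ltd iM.
  have [iL|iL] := boolP (i \in leads Z); last by apply: cut0; rewrite inE iL.
  have /leadsP[w [wZ wi w0]] := iL.
  have := orth w wZ; rewrite (bigD1 i) //= big1 => [|j ji].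
    by rewrite addr0 => /eqP; rewrite mulf_eq0 (negPf wi) => /eqP.
  have [->|wj] := eqVneq (w 0 j) 0; first by rewrite mul0r.
  have ltij : (i < j)%N.
    by rewrite ltn_neqAle eq_sym ji leqNgt; apply: contra wj => /w0 ->.
  rewrite IH ?mulr0 ?(ZM w) //; have := ltn_ord j; lia.
(* Descending induction on rows: a leading cell of row [a] shares its column with a cell of [M] in a
   later row, so both rows have the same potential. *)
have XL0 a : X a = 0.
  have [d] := ubnP (m1 - a); elim: d a => // d IH a ltd.
  have [/imsetP[i iL def_a]|] := boolP (a \in ro @: leads Z); last exact: X0.
  have [w [j [wZ wi wj cij ltij]]] := leads_below Zco iL.
  have ltr : (ro i < ro j)%N by have [_] := ord i j ltij; apply.
  have gij : g i = g j by rewrite !gM // (ZM w).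
  have {}IH : X (ro j) = 0.
    by apply: IH; rewrite def_a in ltd; have := ltn_ord (ro j); lia.
  by move: gij; rewrite /g cij => /addIr/addIr; rewrite -def_a IH.
have [i0 i0L] : exists i, i \in leads Z.
  apply/set0Pn; rewrite -card_gt0 (leq_trans _ (dim_le_leads Z)) //.
  by rewrite lt0n dimv_eq0.
(* In the last column that meets the leading positions, a leading cell has a later cell of [M] in
   its row; the column of that cell carries [Y = 0], which leaves only [c]. *)
have c0 : c = 0.
  have b0 : co i0 \in co @: leads Z by apply: imset_f.
  case: (@arg_maxnP _ (co i0) [in co @: leads Z] (fun b : 'I_m2 => val b) b0).
  move=> b /imsetP[i iL ->] max_b.
  have [w [j [wZ wi wj rij ltij]]] := leads_below Zro iL.
  have ltc : (co i < co j)%N by have [+ _] := ord i j ltij; apply.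
  have := gM j (ZM _ _ wZ wj); rewrite /g XL0 Y0 ?add0r //.
  by apply/negP=> /max_b; rewrite /= leqNgt ltc.
split=> // b.
have [/imsetP[i iL ->]|] := boolP (b \in co @: leads Z); last exact: Y0.
have /leadsP[w [wZ wi _]] := iL.
by have := gM i (ZM _ _ wZ wi); rewrite /g XL0 c0 add0r addr0.
Qed.

Lemma card_le_lines (n m1 m2 : nat) (ro : 'I_n -> 'I_m1)
    (co : 'I_n -> 'I_m2) (L : {set 'I_n}) :
  grid_order ro co -> (#|L| <= #|ro @: L| * #|co @: L|)%N.
Proof.
move=> ord; rewrite -cardsX.
rewrite -(card_in_imset (f := fun i => (ro i, co i))) => [|i j _ _ []].
  apply/subset_leq_card/subsetP=> _ /imsetP[i iL ->].
  by rewrite in_setX /= !imset_f.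
exact: grid_order_inj.
Qed.

Lemma support_card_ge (F : finFieldType) (n m1 m2 : nat) (ro : 'I_n -> 'I_m1)
    (co : 'I_n -> 'I_m2) (M : {set 'I_n}) (Z : {vspace 'rV[F]_n}) :
  grid_order ro co ->
  (forall w, w \in Z -> zero_sums ro w /\ zero_sums co w) ->
  (forall w i, w \in Z -> w 0 i != 0 -> i \in M) ->
  Z != 0%VS ->
  (#|ro @: leads Z| + #|co @: leads Z| + 1 + #|leads Z| <= #|M|)%N.
Proof.
move=> ord Zsum ZM Z0; set L := leads Z; set U := ro @: L; set V := co @: L.
have sLM : L \subset M.
  by apply/subsetP=> i /leadsP[w [wZ wi _]]; apply: ZM wi.
suff: (#|U| + #|V| + 1 <= #|M :\: L|)%N.
  rewrite cardsD (setIidPr sLM); have := subset_leq_card sLM; lia.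
pose T := M :\: L; pose eT := enum_val (A := mem T).
pose KX : 'M[F]_(#|U|, #|T|) :=
  \matrix_(a, i) (ro (eT i) == enum_val a)%:R.
pose KY : 'M[F]_(#|V|, #|T|) :=
  \matrix_(b, i) (co (eT i) == enum_val b)%:R.
pose K := col_mx (col_mx KX KY) (const_mx 1 : 'M[F]_(1, #|T|)).
(* Independent rows of [K] are at most as many as its columns, which are indexed by [T]. *)
suff /eqP <- : row_free K by exact: rank_leq_col.
apply: inj_row_free => v.
rewrite -[v]hsubmxK -[lsubmx v]hsubmxK.
set x := lsubmx (lsubmx v); set y := rsubmx (lsubmx v); set c := rsubmx v.
rewrite !mul_row_col => /rowP vK0.
(* [X] and [Y] extend the coefficients by zero to the lines that miss [L]. *)
pose X a := \sum_j x 0 j * (a == enum_val j)%:R.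
pose Y b := \sum_j y 0 j * (b == enum_val j)%:R.
have [||i iT|X0 Y0 c0] :=
    @cut_eq0 F n m1 m2 ro co M Z X Y (c 0 0) ord Zsum ZM Z0.
- move=> a aU; apply: big1 => j _; case: eqP => [def_a|]; last by rewrite mulr0.
  by case/negP: aU; rewrite def_a enum_valP.
- move=> a aU; apply: big1 => j _; case: eqP => [def_a|]; last by rewrite mulr0.
  by case/negP: aU; rewrite def_a enum_valP.
- have := vK0 (enum_rank_in iT i); rewrite !mxE big_ord1 !mxE mulr1 => <-.
  congr (_ + _ + _).
    by apply: eq_bigr => j _; rewrite !mxE /eT enum_rankK_in.
  by apply: eq_bigr => j _; rewrite !mxE /eT enum_rankK_in.
have -> : c = 0 by apply/rowP=> j; rewrite [j]ord1 c0 mxE.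
have -> : x = 0.
  apply/rowP=> j; rewrite [RHS]mxE -(X0 (enum_val j)).
  rewrite /X (bigD1 j) //= eqxx mulr1.
  rewrite big1 ?addr0 // => l lj; rewrite (inj_eq enum_val_inj) eq_sym.
  by rewrite (negPf lj) mulr0.
have -> : y = 0.
  apply/rowP=> j; rewrite [RHS]mxE -(Y0 (enum_val j)).
  rewrite /Y (bigD1 j) //= eqxx mulr1.
  rewrite big1 ?addr0 // => l lj; rewrite (inj_eq enum_val_inj) eq_sym.
  by rewrite (negPf lj) mulr0.
by rewrite !row_mx0.
Qed.

(** * Subcodes of the grid code *)

Definition line_check (F : fieldType) (n m : nat) (p : 'I_n -> 'I_m) :
    'M[F]_(n, m) :=
  \matrix_(i, a) (p i == a)%:R.

Definition grid_code (F : fieldType) (n m1 m2 : nat) (ro : 'I_n -> 'I_m1)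
    (co : 'I_n -> 'I_m2) : {vspace 'rV[F]_n} :=
  lker (linfun (mulmxr (row_mx (line_check F ro) (line_check F co)))).

Definition supported_on (F : fieldType) (n : nat) (M : {set 'I_n}) :
    {vspace 'rV[F]_n} :=
  lker (linfun (mulmxr (diag_mx (\row_i (i \notin M)%:R)))).

Lemma mul_line_check (F : fieldType) (n m : nat) (p : 'I_n -> 'I_m)
    (w : 'rV[F]_n) a :
  (w *m line_check F p) 0 a = \sum_(i | p i == a) w 0 i.
Proof.
rewrite mxE [RHS]big_mkcond; apply: eq_bigr => i _.
by rewrite mxE; case: eqP; rewrite ?mulr1 ?mulr0.
Qed.

Lemma grid_codeP (F : fieldType) (n m1 m2 : nat) (ro : 'I_n -> 'I_m1)
    (co : 'I_n -> 'I_m2) (w : 'rV[F]_n) :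
  w \in grid_code F ro co <-> zero_sums ro w /\ zero_sums co w.
Proof.
rewrite memv_ker lfunE /= mul_mx_row; split.
  move=> /eqP; rewrite -[0](@row_mx0 _ 1 m1 m2).
  case/eq_row_mx=> /rowP Hr /rowP Hc.
  by split=> a; rewrite -mul_line_check (Hr, Hc) mxE.
case=> Hr Hc; apply/eqP; rewrite -[RHS](@row_mx0 _ 1 m1 m2).
by congr row_mx; apply/rowP=> a; rewrite mul_line_check mxE ?Hr ?Hc.
Qed.

Lemma supported_onP (F : fieldType) (n : nat) (M : {set 'I_n}) (w : 'rV[F]_n) :
  w \in supported_on F M <-> forall i, w 0 i != 0 -> i \in M.
Proof.
rewrite memv_ker lfunE /= mul_mx_diag; split.
  move=> /eqP/rowP wM i; apply: contraNT => iM.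
  by have := wM i; rewrite !mxE iM mulr1 => ->.
move=> wM; apply/eqP/rowP => i; rewrite !mxE.
have [iM|iM] := boolP (i \in M); first by rewrite mulr0.
by rewrite mulr1; apply/eqP; apply: contraNT iM => /wM.
Qed.

(* The row sums and the column sums of an array have the same total, so the
   [m1 + m2] parity checks are dependent. *)
Lemma dim_grid_code (F : fieldType) (n m1 m2 : nat) (ro : 'I_n -> 'I_m1)
    (co : 'I_n -> 'I_m2) :
  (0 < m1)%N -> (n < \dim (grid_code F ro co) + (m1 + m2))%N.
Proof.
case: m1 ro => // m1 ro _.
rewrite /grid_code; set f := linfun _.
have := limg_ker_dim f fullv; rewrite capfv dimvf /dim /= mul1n => {1}<-.
rewrite ltn_add2l -[X in (_ < X)%N]mul1n.
rewrite -[X in (_ < X)%N](@dimvf F 'rV[F]_(m1.+1 + m2)).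
rewrite (ltn_leqif (dimv_leqif_eq (subvf _))).
apply: contraT; rewrite negbK => /eqP full.
have : row_mx (delta_mx 0 0) 0 \in limg f by rewrite full memvf.
case/memv_imgP => w _; rewrite lfunE /= mul_mx_row.
case/eq_row_mx=> /rowP Hr /rowP Hc.
have sum_ro : \sum_i w 0 i = 1.
  rewrite (partition_big ro predT) //=.
  under eq_bigr => a _ do rewrite -mul_line_check -Hr mxE eqxx.
  by rewrite (bigD1 0) //= big1 ?addr0 // => a /negPf->.
have := oner_neq0 F.
rewrite -sum_ro (partition_big co predT) //= big1 ?eqxx // => b _.
by rewrite -mul_line_check -Hc mxE.
Qed.

(** The columns of [G] along a line sum to zero. *)
Lemma line_span (F : fieldType) (n m k : nat) (p : 'I_n -> 'I_m)
    (G : 'M[F]_(k, n)) (i : 'I_n) :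
  (forall a, zero_sums p (row a G)) ->
  col i G \in col_span G ([set j | p j == p i] :\ i).
Proof.
move=> Gp; set N := _ :\ i.
have -> : col i G = - \sum_(j in N) col j G.
  apply/eqP; rewrite -subr_eq0 opprK; apply/eqP/colP => a.
  have := Gp a (p i); rewrite (bigD1 i) //= !mxE summxE => Gai.
  rewrite -[RHS]Gai; congr (_ + _).
  by apply: eq_big => [j|j _]; rewrite ?inE 1?andbC // !mxE.
rewrite rpredN; apply: rpred_sum => j jN; apply: memv_span.
by apply: map_f; rewrite mem_enum.
Qed.

Lemma grid_locality (F : fieldType) (n r : nat) (ro co : 'I_n -> 'I_r.+1)
    (C : {vspace 'rV[F]_n}) :
  grid_order ro co ->
  (forall w, w \in C -> zero_sums ro w /\ zero_sums co w) ->
  all_symbol_locality C r 3.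
Proof.
move=> ord Csum k G genG i.
have rowC a : row a G \in C.
  by apply: (basis_mem genG); apply: map_f; rewrite mem_enum.
pose line (p : 'I_n -> 'I_r.+1) := [set j | p j == p i] :\ i.
have cardline (p q : 'I_n -> 'I_r.+1) :
    (forall j l, p j = p l -> q j = q l -> j = l) -> (#|line p| <= r)%N.
  move=> inj; have := cardsD1 i [set j | p j == p i]; rewrite inE eqxx add1n.
  suff : (#|[set j | p j == p i]| <= r.+1)%N by move=> /[swap] ->; rewrite ltnS.
  (* The other coordinate [q] is injective on a line of [p]. *)
  rewrite -(card_in_imset (f := q)) => [|j l].
    by rewrite -[X in (_ <= X)%N]card_ord max_card.
  by rewrite !inE => /eqP pj /eqP pl; apply: inj; rewrite pj pl.
have rc j l : ro j = ro l -> co j = co l -> j = l by apply: grid_order_inj.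
have dis : [disjoint line ro & line co].
  rewrite -setI_eq0; apply/eqP/setP => j; rewrite !inE.
  apply/negP => /andP[/andP[ji /eqP rj] /andP[_ /eqP cj]].
  by case/eqP: ji; apply: rc.
exists (fun xi => line (if val xi == 0%N then ro else co)); split.
  move=> xi; split; first by rewrite !inE eqxx.
    case: ifP => _; first exact: (cardline _ co).
    by apply: (cardline _ ro) => j l cj rj; apply: rc.
  by case: ifP => _; apply: line_span => a; have [] := Csum _ (rowC a).
move=> [[|[|//]] lt1] [[|[|//]] lt2] //= neq; last by rewrite disjoint_sym.
Qed.

Definition weight (F : fieldType) (n : nat) (w : 'rV[F]_n) : nat :=
  #|[set i | w 0 i != 0]|.

Lemma min_dist_exists (F : finFieldType) (n D : nat) (C : {vspace 'rV[F]_n}) :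
  C != 0%VS ->
  (forall w, w \in C -> w != 0 -> (D <= weight w)%N) ->
  exists2 d, is_min_dist C d & (D <= d)%N.
Proof.
move=> C0 CD.
have v0 : (vpick C \in C) && (vpick C != 0) by rewrite memv_pick vpick0.
case: (@arg_minnP _ (vpick C) (fun w => (w \in C) && (w != 0))
         (@weight F n) v0).
move=> w /andP[wC w0] min_w.
have distE u v : hamming_dist u v = weight (u - v).
  by apply: eq_card => i; rewrite !inE !mxE subr_eq0.
exists (weight w); last exact: CD.
split.
  by exists w, 0; rewrite mem0v distE subr0.
by move=> u v uC vC uv; rewrite distE min_w // rpredB // subr_eq0.
Qed.

(** * Numbering of the cells and bounds on [mu] *)

Definition grid_row (r n : nat) (i : 'I_n) : 'I_r.+1 := inord (i %/ r.+1).
Definition grid_col (r n : nat) (i : 'I_n) : 'I_r.+1 := inord (i %% r.+1).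

Lemma grid_row_col_order (r n : nat) :
  n = (r.+1 ^ 2)%N -> grid_order (@grid_row r n) (@grid_col r n).
Proof.
(* The value of [n] keeps the quotient at most [r], so [inord] does not fall back to its default. *)
move=> def_n; have rowE (i : 'I_n) : grid_row r i = (i %/ r.+1)%N :> nat.
  by rewrite inordK // ltn_divLR // -[(_ * _)%N]/(r.+1 ^ 2)%N -def_n.
have colE (i : 'I_n) : grid_col r i = (i %% r.+1)%N :> nat.
  by rewrite inordK // ltn_mod.
move=> i j ltij; split=> /(congr1 val) /=; rewrite ?(rowE, colE) => eqij.
  by move: ltij; rewrite {1}(divn_eq i r.+1) {1}(divn_eq j r.+1) eqij ltn_add2l.
move: ltij; rewrite {1}(divn_eq i r.+1) {1}(divn_eq j r.+1) eqij.
by rewrite ltn_add2r ltn_mul2r.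
Qed.

(** Completing the square: what is taken off [r ^ 2] is the largest product of two numbers with sum
    [2 * r - x]. The factors are equal here and differ by one for odd [x]. *)
Lemma f_lines_double (r m : nat) :
  (m <= r)%N -> (f_lines r m.*2 - m.*2 = r ^ 2 - (r - m) ^ 2)%N.
Proof.
move=> lemr; rewrite /f_lines odd_double.
have -> : (m.*2 ^ 2 = m ^ 2 * 4)%N by rewrite -mul2n; lia.
by rewrite mulnK //; nia.
Qed.

Lemma f_lines_doubleS (r m : nat) :
  (m < r)%N ->
  (f_lines r m.*2.+1 - m.*2.+1 = r ^ 2 - (r - m) * (r - m.+1))%N.
Proof.
move=> ltmr; rewrite /f_lines /= odd_double /=.
have -> : (m.*2.+1 ^ 2 - 1 = (m ^ 2 + m) * 4)%N by rewrite -mul2n; lia.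
by rewrite mulnK //; nia.
Qed.

Lemma f_lines_max (r : nat) : (f_lines r r.*2.+1 - r.*2.+1 = r ^ 2)%N.
Proof.
rewrite /f_lines /= odd_double /=.
have -> : (r.*2.+1 ^ 2 - 1 = (r ^ 2 + r) * 4)%N by rewrite -mul2n; lia.
by rewrite mulnK //; nia.
Qed.

(* With [t = 2 * r - x], the condition [f x - x <= k - 1] says that
   [r <= t ^ 2 %/ 4], the largest product of two numbers with sum [t]. *)
Lemma mu_add_ge (r k u v : nat) :
  k = (r ^ 2 - r + 1)%N -> (0 < r)%N -> (r <= u * v)%N ->
  (2 * r <= mu r k + (u + v))%N.
Proof.
move=> def_k r0 ler; rewrite leqNgt; apply/negP => lt_t.
(* This [x] exceeds [mu r k], so it contradicts maximality once it satisfies the defining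
   condition. *)
set x := (2 * r - (u + v))%N.
have agm : (4 * (u * v) <= (u + v) ^ 2)%N by case: (nat_AGM2 u v).
suff cond : (f_lines r x - x <= k - 1)%N.
  have xin : x \in index_iota 1 (2 * r + 1).+1.
    by rewrite mem_index_iota /x; lia.
  have : (x <= mu r k)%N.
    exact: (leq_bigmax_seq (P := fun x => (f_lines r x - x <= k - 1)%N)
              (F := fun x => x) x xin cond).
  by rewrite /x; lia.
have [m [def_m|def_m]] : exists m, x = m.*2 \/ x = m.*2.+1.
- exists x./2; have := odd_double_half x; case: (odd x) => /=; lia.
- have lem : (m <= r)%N by rewrite /x in def_m; lia.
  rewrite def_m f_lines_double // def_k addnK leq_sub2l //.
  have def_uv : (u + v = (r - m) + (r - m))%N by rewrite /x in def_m; lia.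
  by move: agm; rewrite def_uv; lia.
have ltm : (m < r)%N by rewrite /x in def_m; lia.
rewrite def_m f_lines_doubleS // def_k addnK leq_sub2l //.
have def_uv : (u + v = (r - m) + (r - m.+1))%N by rewrite /x in def_m; lia.
have rmS : (r - m = (r - m.+1).+1)%N by lia.
(* With [a = r - m.+1], [4 * (u * v) <= (2 * a + 1) ^ 2 = 4 * a * (a + 1) + 1], and integrality
   removes the 1. *)
by move: agm; rewrite def_uv rmS; lia.
Qed.

(** For larger [x], two numbers with sum [2 * r - x <= 2 * s] have product at most [s ^ 2 < r], so
    the condition fails. *)
Lemma mu_le (r k s : nat) :
  k = (r ^ 2 - r + 1)%N -> (s ^ 2 < r)%N -> (mu r k + (2 * s + 1) <= 2 * r)%N.
Proof.
move=> def_k lts; suff : (mu r k <= 2 * r - (2 * s + 1))%N by nia.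
apply/bigmax_leqP_seq => x; rewrite mem_index_iota => /andP[_ ltx].
apply: contraLR; rewrite -!ltnNge def_k addnK => gtx.
have lesr : (s < r)%N by nia.
have [m [def_m|def_m]] : exists m, x = m.*2 \/ x = m.*2.+1.
- exists x./2; have := odd_double_half x; case: (odd x) => /=; lia.
- rewrite def_m f_lines_double; last by lia.
  have lems : (r - m <= s)%N by lia.
  have : ((r - m) ^ 2 <= s ^ 2)%N by rewrite leq_sqr.
  nia.
have [eqm|neqm] := eqVneq m r; first by rewrite def_m eqm f_lines_max; nia.
rewrite def_m f_lines_doubleS; last by lia.
have : ((r - m) * (r - m.+1) <= s * s)%N by apply: leq_mul; lia.
nia.
Qed.

(** * Construction of the code *)

Lemma supported_dim_lt (F : finFieldType) (n r k : nat)
    (M : {set 'I_n}) :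
  (0 < r)%N -> n = (r.+1 ^ 2)%N -> k = (r ^ 2 - r + 1)%N ->
  #|M| = (3 * r - mu r k)%N ->
  (\dim (grid_code F (@grid_row r n) (@grid_col r n)
          :&: supported_on F M) < r)%N.
Proof.
move=> r0 def_n def_k cardM; set Z := (_ :&: _)%VS.
rewrite ltnNge; apply/negP => ledim.
have ord := grid_row_col_order def_n.
have Zsum w : w \in Z ->
    zero_sums (@grid_row r n) w /\ zero_sums (@grid_col r n) w.
  by rewrite memv_cap => /andP[/grid_codeP].
have ZM w i : w \in Z -> w 0 i != 0 -> i \in M.
  by rewrite memv_cap => /andP[_ /supported_onP]; apply.
have Z0 : Z != 0%VS by rewrite -dimv_eq0 -lt0n (leq_trans r0).
have := support_card_ge ord Zsum ZM Z0; rewrite cardM => leM.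
have leL := dim_le_leads Z.
have leZ := leq_trans ledim leL.
have := mu_add_ge def_k r0 (leq_trans leZ (card_le_lines (leads Z) ord)).
move: leM leZ; move: #|_| #|_| #|_| => a b c; lia.
Qed.

Lemma grid_subcode_exists (F : finFieldType) (n r k s : nat) :
  (0 < r)%N -> n = (r.+1 ^ 2)%N -> k = (r ^ 2 - r + 1)%N ->
  (s ^ 2 < r)%N -> ('C(n, k + mu r k) < #|F|)%N ->
  exists (C : {vspace 'rV[F]_n}) (d : nat),
    [/\ \dim C = k, all_symbol_locality C r 3, is_min_dist C d
      & (r + 2 * s + 2 <= d)%N].
Proof.
move=> r0 def_n def_k lts ltF; have ord := grid_row_col_order def_n.
pose P := grid_code F (@grid_row r n) (@grid_col r n).
pose e := (3 * r - mu r k)%N.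
have le_mu := mu_le def_k lts.
have ler2 : (r <= r ^ 2)%N by nia.
(* Here [n - k = 3 * r]. *)
have e_n : e = (n - (k + mu r k))%N by rewrite /e; lia.
have len : (k + mu r k <= n)%N by lia.
pose A := [set M : {set 'I_n} | #|M| == e].
have cardA : #|A| = 'C(n, k + mu r k).
  by rewrite card_draws card_ord e_n bin_sub.
have A0 : A != set0 by rewrite -card_gt0 cardA bin_gt0.
have dimP := dim_grid_code F (@grid_row r n) (@grid_col r n) (ltn0Sn r).
have [|M|C [sCP dimC capC]] :=
    @generic_subspace F n _ A P (fun M => P :&: supported_on F M)%VS k A0.
- by rewrite cardA.
- rewrite inE => /eqP cardM.
  have := supported_dim_lt F r0 def_n def_k cardM; rewrite -/P.
  move: dimP; rewrite -/P.
  suff arith a b : (n < a + (r.+1 + r.+1) -> b < r -> k + b <= a)%N.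
    exact: arith.
  lia.
have Csum w : w \in C ->
    zero_sums (@grid_row r n) w /\ zero_sums (@grid_col r n) w.
  by move=> /(subvP sCP)/grid_codeP.
have [||d min_d led] := @min_dist_exists F n (r + 2 * s + 2) C.
- by rewrite -dimv_eq0 dimC def_k addn1.
(* By [mu_le], [r + 2 * s + 1 <= e], so the support of a lighter word fits in a set [M] of [e]
   cells, where [C] has only the zero word. *)
- move=> w wC w0; rewrite leqNgt; apply/negP => lt_w.
  have [|M sM cardM] := @exists_set_of_card _ [set i | w 0 i != 0] e.
    by rewrite -/(weight w) card_ord; rewrite /e in e_n *; lia.
  case/eqP: w0; apply/eqP; rewrite -memv0 -(capC M) ?inE ?cardM //.
  rewrite !memv_cap wC (subvP sCP) //=; apply/supported_onP => i wi.
  by apply: (subsetP sM); rewrite inE.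
by exists C, d; split=> //; apply: grid_locality ord Csum.
Qed.

(** * Real estimates *)

(* Not imported above: the set lemmas of [classical_sets] shadow [finset]'s. *)
From mathcomp Require Import all_classical all_reals all_analysis.
From mathcomp Require Import ring lra.
Import numFieldNormedType.Exports.

Local Open Scope classical_set_scope.

Lemma floor_sqrt_pred (R : realType) (r : nat) :
  (0 < r)%N ->
  exists2 s : nat, (s ^ 2 < r)%N & Num.floor (Num.sqrt (r%:R - 1 : R)) = s%:Z.
Proof.
move=> r0; set x : R := Num.sqrt _.
have x0 : 0 <= x by rewrite sqrtr_ge0.
have : 0 <= Num.floor x by rewrite floor_ge0.
case def_s : (Num.floor x) => [s|//] _; exists s => //.
have := floor_le x; rewrite def_s => les.
have sqx : x ^+ 2 = r%:R - 1 by rewrite sqr_sqrtr // subr_ge0 ler1n.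
have : (s%:R : R) ^+ 2 <= r%:R - 1 by rewrite -sqx lerXn2r // ?nnegrE ?ler0n.
by rewrite -natrX lerBrDr natr1 ler_nat.
Qed.

(** The quotient is [r - 1 + 1 / r]. *)
Lemma ceil_dim_div (R : realType) (r : nat) :
  (1 < r)%N -> Num.ceil ((r ^ 2 - r + 1)%N%:R / r%:R : R) = r%:Z.
Proof.
move=> r1; have r0 : (0 : R) < r%:R by rewrite ltr0n; lia.
apply: ceil_def; rewrite ltr_pdivlMr // ler_pdivrMr // intrD.
have -> : (r ^ 2 - r + 1)%N%:R = r%:R ^+ 2 - r%:R + 1 :> R.
  by rewrite natrD natrB ?natrX //; nia.
have : (1 : R) < r%:R by rewrite ltr1n.
rewrite mulrNz pmulrn; nra.
Qed.

Lemma floor_sqrt_Omega (R : realType) :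
  (fun r : nat =>
     (2 * (Num.floor (Num.sqrt (r%:R - 1 : R)) - 1) + 1)%:~R : R)
    =Omega_\oo (fun r : nat => Num.sqrt (r%:R : R)).
Proof.
rewrite eqOmegaE qualifE; apply/asboolP; exists 1 => //.
near=> r; rewrite mul1r.
(* With [x] and [y] the roots of [r - 1] and [r], the left side exceeds [2 * x - 3 >= 2 * y - 5],
   which is at least [y] once [y >= 5]. *)
have ler : (25 <= r)%N by near: r; exact: nbhs_infty_ge.
rewrite ger0_norm ?sqrtr_ge0 //; apply: le_trans (ler_norm _).
set x := Num.sqrt (r%:R - 1); set y := Num.sqrt r%:R.
have lex : x < (Num.floor x)%:~R + 1 by rewrite -[1]/(1%:~R) -intrD floorD1_gt.
have x0 : 0 <= x by exact: sqrtr_ge0.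
have y0 : 0 <= y by exact: sqrtr_ge0.
have sqx : x ^+ 2 = r%:R - 1 by rewrite sqr_sqrtr // subr_ge0 ler1n; lia.
have sqy : y ^+ 2 = r%:R by rewrite sqr_sqrtr.
have ler' : (25 : R) <= r%:R by rewrite ler_nat.
have y5 : 5 <= y by nra.
have xy : y - 1 <= x by nra.
rewrite intrD intrM intrB; lra.
Unshelve. all: by end_near. Qed.

Lemma rate_cvg (R : realType) :
  (fun r : nat => (r ^ 2 - r + 1)%N%:R / ((r + 1) ^ 2)%N%:R : R) @ \oo
     --> (1 : R).
Proof.
pose h : R^nat := @harmonic R.
(* This expands [r ^ 2 - r + 1 = (r + 1) ^ 2 - 3 * (r + 1) + 3]. *)
have -> : (fun r : nat => (r ^ 2 - r + 1)%N%:R / ((r + 1) ^ 2)%N%:R : R)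
   = (fun r => 1 - 3 * h r + 3 * (h r * h r)).
  apply/funext => r; rewrite /h /harmonic /=.
  have -> : (r ^ 2 - r + 1)%N%:R = r%:R ^+ 2 - r%:R + 1 :> R.
    by rewrite natrD natrB ?natrX //; nia.
  rewrite natrX natrD -[in r.+1]addn1 natrD.
  have : (r%:R + 1 : R) != 0 by rewrite natr1 pnatr_eq0.
  by move=> r1; field.
have h0 : h @ \oo --> (0 : R) by exact: cvg_harmonic.
have c1 : (fun=> 1 : R) @ \oo --> (1 : R) by exact: cvg_cst.
have c3 : (fun=> 3 : R) @ \oo --> (3 : R) by exact: cvg_cst.
have := cvgD (cvgB c1 (cvgM c3 h0)) (cvgM c3 (cvgM h0 h0)).
by rewrite !mulr0 subr0 addr0; apply.
Qed.

Theorem mainTheorem4 (R : realType) :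
  [/\ forall (r n k : nat), (2 <= r)%N ->
        n = ((r + 1) ^ 2)%N -> k = (r ^ 2 - r + 1)%N ->
        forall F : finFieldType, ('C(n, k + mu r k) < #|F|)%N ->
        exists (C : {vspace 'rV[F]_n}) (d : nat),
          [/\ \dim C = k,
              all_symbol_locality C r 3,
              is_min_dist C d,
              n%:Z - k%:Z + 1
                - (2 * (r%:Z - Num.floor (Num.sqrt (r%:R - 1 : R))) - 1)
                <= d%:Z
            & 2 * (Num.floor (Num.sqrt (r%:R - 1 : R)) - 1) + 1
                <= d%:Z - (n%:Z - k%:Z + 1
                           - (Num.ceil (k%:R / r%:R : R) - 1) * (3 - 1))],
      (fun r : nat =>
         (2 * (Num.floor (Num.sqrt (r%:R - 1 : R)) - 1) + 1)%:~R : R)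
        =Omega_\oo (fun r : nat => Num.sqrt (r%:R : R))
    & (fun r : nat => (r ^ 2 - r + 1)%N%:R / ((r + 1) ^ 2)%N%:R : R) @ \oo
        --> (1 : R)].
Proof.
split; [|exact: floor_sqrt_Omega|exact: rate_cvg].
move=> r n k r2 def_n def_k F ltF.
have r0 : (0 < r)%N by exact: ltnW.
have [s lts floorE] := floor_sqrt_pred R r0.
have def_n' : n = (r.+1 ^ 2)%N by rewrite def_n addn1.
have [C [d [dimC loc min_d led]]] :=
  grid_subcode_exists r0 def_n' def_k lts ltF.
exists C, d; rewrite floorE def_k ceil_dim_div // -def_k.
(* As [n - k = 3 * r] and the ceiling is [r], both bounds amount to [r + 2 * s + 2 <= d]. *)
split=> //; lia.
Qed.
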